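(* There are constants $c,d>0$ such that for every sufficiently large natural number $n$ there are at least $\lfloor 2^n/d\rfloor$ binary strings $x$ with $n-c \leq l(x) \leq n$ and $C(x\mid n) > n$; likewise, there are constants $c,d>0$ such that for every sufficiently large $n$ there are at least $\lfloor 2^n/d\rfloor$ binary strings $x$ with $n-c\le l(x)\le n$ and $C(x) > n$.
   Context: Fix a standard enumeration $T_0,T_1,\ldots$ of Turing machines and a universal Turing machine $U$ with $U(\langle\langle i,p\rangle,y\rangle)=T_i(\langle p,y\rangle)$, where $\langle\cdot,\cdot\rangle$ is a standard one-to-one pairing of strings. The conditional Kolmogorov complexity is $C(x\mid y)=\min\{l(p): U(\langle p,y\rangle)=x\}$, where $l(p)$ is the length of the binary string $p$, and $C(x)=C(x\mid\epsilon)$ with $\epsilon$ the empty string. Natural numbers are identified with binary strings via the length-increasing lexicographic order ($\epsilon\mapsto 0$, $0\mapsto 1$, $1\mapsto 2$, $00\mapsto 3,\ldots$), so $C(x\mid n)$ makes sense. *)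

(* Defs.v *)
From mathcomp Require Import all_boot.
From mathcomp Require Import boolp.

Set Implicit Arguments.
Unset Strict Implicit.
Unset Printing Implicit Defensive.

(** Binary strings are [seq bool], most significant bit first. *)

(* Successor for the length-increasing lexicographic order, on strings written
   least significant bit first. *)
Fixpoint lsucc (s : seq bool) : seq bool :=
  match s with
  | [::] => [:: false]
  | false :: s' => true :: s'
  | true :: s' => false :: lsucc s'
  end.

(* The string identified with n: 0, 1, 2, 3, ... |-> empty, 0, 1, 00, ... *)
Definition str (n : nat) : seq bool := rev (iter n lsucc [::]).

(* The standard self-delimiting pairing <x,y> = 1^l(x) 0 x y. *)
Definition pair (x y : seq bool) : seq bool :=
  nseq (size x) true ++ false :: x ++ y.

(** Deterministic Turing machines over {0, 1, blank}, with one two-way infinite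
    tape; each instruction either rewrites the scanned cell or moves the head. *)

Definition symbol := option bool. (* [None] is the blank *)

Inductive action := Write of symbol | Left | Right.

(* States are 0, ..., nstates, with initial state 0; the machine halts when no
   instruction applies ([None]). *)
Record TM := MkTM {
  nstates : nat;
  delta : {ffun 'I_nstates.+1 * symbol -> option (action * 'I_nstates.+1)}
}.

(* [ltape] lists the cells to the left of the head from right to left, and
   [rtape] those to its right; unlisted cells are blank. *)
Record config (M : TM) := Config {
  state : 'I_(nstates M).+1;
  ltape : seq symbol;
  scanned : symbol;
  rtape : seq symbol
}.

Definition init (M : TM) (x : seq bool) : config M :=
  let t := map Some x in @Config M ord0 [::] (head None t) (behead t).

Definition step (M : TM) (c : config M) : option (config M) :=
  let: Config q l s r := c in
  match delta M (q, s) with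
  | None => None
  | Some (Write s', q') => Some (Config q' l s' r)
  | Some (Left, q') => Some (Config q' (behead l) (head None l) (s :: r))
  | Some (Right, q') => Some (Config q' (s :: l) (head None r) (behead r))
  end.

Fixpoint bits (t : seq symbol) : seq bool :=
  if t is Some b :: t' then b :: bits t' else [::].

(* The maximal blank-free block containing the scanned cell; the empty string
   if that cell is blank. *)
Definition output (M : TM) (c : config M) : seq bool :=
  if scanned c is Some b then rev (bits (ltape c)) ++ b :: bits (rtape c)
  else [::].

(* M(x) = z for the partial function of M: M halts on x with output z. *)
Definition computes (M : TM) (x z : seq bool) : Prop :=
  exists (t : nat) (c : config M),
    [/\ iter t (obind (@step M)) (Some (init M x)) = Some c,
        step c = None & output c = z].

Definition enumeration (T : nat -> TM) : Prop :=
  forall M : TM, exists i : nat, T i = M.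

(* U(<<i,p>,y>) = T_i(<p,y>) as partial functions.  Such a machine U can exist
   only if the T_i are uniformly computable on pairs; effectiveness of the
   enumeration is not required beyond that. *)
Definition universal (T : nat -> TM) (U : TM) : Prop :=
  forall (i : nat) (p y z : seq bool),
    computes U (pair (pair (str i) p) y) z <-> computes (T i) (pair p y) z.

Definition has_program (U : TM) (x y : seq bool) (k : nat) : bool :=
  `[< exists p : seq bool, size p = k /\ computes U (pair p y) x >].

(* C(x | y) relative to U.  The default 0 is used only if x has no program
   given y, which does not happen when U is universal. *)
Definition C (U : TM) (x y : seq bool) : nat :=
  if pselect (exists k, has_program U x y k) is left h then ex_minn h else 0.

(* Main.v *)
(** A prefix [e] of programs on which [U] diverges wastes [2 ^ (n - size e)] of
    the programs of length [n].  There are as many strings as programs of length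
    at most [n], so as many strings of length at most [n] have complexity
    greater than [n], and fewer than half that number of strings are shorter
    than [n - size e - 1].  Take [e] to be the index of a machine that never
    halts. *)
Require Import Defs.
From mathcomp Require Import all_boot.
From mathcomp Require Import boolp.

Set Implicit Arguments.
Unset Strict Implicit.
Unset Printing Implicit Defensive.

Lemma iter_obind_step_halted (M : TM) (c : config M) (k : nat) :
  step c = None -> iter k.+1 (obind (@step M)) (Some c) = None.
Proof. by move=> hc; elim: k => [|k IHk] //; rewrite iterS IHk. Qed.

Lemma computes_inj (M : TM) (w x x' : seq bool) :
  computes M w x -> computes M w x' -> x = x'.
Proof.
move=> [t [c [itc hc <-]]] [t' [c' [itc' hc' <-]]].
wlog le_tt' : t t' c c' itc hc itc' hc' / t <= t'.
  move=> H; case/orP: (leq_total t t') => le_t; first exact: (H t t').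
  by symmetry; apply: (H t' t).
move: itc'; rewrite -(subnK le_tt') iterD itc.
by case: (t' - t) => [[<-] // | k]; rewrite iter_obind_step_halted.
Qed.

Definition loop_TM : TM := @MkTM 0 [ffun _ => Some (Write None, ord0)].

(** [delta] is defined everywhere, so no configuration is halted. *)
Lemma loop_TM_diverges (w x : seq bool) : ~ computes loop_TM w x.
Proof. by case=> t [[q l s r] [_ /=]]; rewrite ffunE. Qed.

(* Blanks the first input cell and then writes [x] from right to left, so that
   the input remains to the right of a blank.  Even states write the scanned
   cell and odd states move left. *)
Definition const_TM (x : seq bool) : TM :=
  @MkTM (size x).*2.+1 [ffun qs : 'I_(size x).*2.+2 * symbol =>
    if qs.1 < (size x).*2.+1 then
      Some (if odd qs.1 then Left
            else Write (nth None (None :: rev (map Some x)) qs.1./2),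
            inord qs.1.+1)
    else None].

Lemma bits_map_Some (x : seq bool) (r : seq symbol) :
  bits (map Some x ++ None :: r) = x.
Proof. by elim: x => //= b x ->. Qed.

(** Loop invariant: after the initial blanking, each letter of [x], taken from the last, costs one
    move left and one write. *)
Lemma const_TM_run (x w : seq bool) (k : nat) : k <= size x ->
  exists (s : symbol) (r r' : seq symbol),
    iter k.*2.+1 (obind (@step (const_TM x))) (Some (init (const_TM x) w)) =
      Some (@Config (const_TM x) (inord k.*2.+1) [::] s r) /\
    s :: r = drop (size x - k) (map Some x) ++ None :: r'.
Proof.
elim: k => [|k IHk] lekx.
  exists None, (behead (map Some w)), (behead (map Some w)).
  by rewrite /= ffunE /= subn0 drop_oversize ?size_map.
have [s [r [r' [run def_sr]]]] := IHk (ltnW lekx).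
exists (nth None (rev (map Some x)) k), (s :: r), r'; split; last first.
  have lt_i : size x - k.+1 < size (map Some x).
    by rewrite size_map ltn_subrL (leq_trans _ lekx).
  rewrite def_sr nth_rev ?size_map // (drop_nth None lt_i).
  by rewrite subnSK.
rewrite doubleS (iterS k.*2.+2) (iterS k.*2.+1) run /= ffunE /=.
have lt1 : k.*2.+1 < (size x).*2.+1 by rewrite ltnS ltn_double.
have lt2 : k.*2.+2 < (size x).*2.+1 by rewrite ltnS -doubleS leq_double.
rewrite (inordK (leqW lt1)) lt1 /= odd_double /= ffunE /=.
by rewrite (inordK (leqW lt2)) lt2 /= odd_double /= doubleK.
Qed.

Lemma computes_const_TM (x w : seq bool) : computes (const_TM x) w x.
Proof.
have [s [r [r' [run def_sr]]]] := const_TM_run w (leqnn (size x)).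
exists (size x).*2.+1, (@Config (const_TM x) (inord (size x).*2.+1) [::] s r).
split; first exact: run.
- by rewrite /= ffunE /= inordK // ltnn.
- move: def_sr {run}; rewrite subnn drop0 /output.
  (* For empty [x] the head stands on the blank, where [output] is empty. *)
  by case: x => [|b x] /= [-> def_r] //; rewrite def_r bits_map_Some.
Qed.

Lemma insub_bseqK (n : nat) (s : seq bool) :
  size s <= n -> insub_bseq n s = s :> seq bool.
Proof. by move=> le_sn; rewrite /insub_bseq val_insubd le_sn. Qed.

Lemma card_short_bseq (n m : nat) :
  #|[set x : n.-bseq bool | size x < m]| <= 2 ^ m.
Proof.
case: m => [|m].
  by rewrite leqW // leqn0 cards_eq0 -subset0; apply/subsetP => x; rewrite inE.
have -> : 2 ^ m.+1 = #|{: m.-bseq bool}|.+1.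
  rewrite card_bseq card_bool -(mul1n (\sum_(i < _) _)) -(predn_exp 2).
  by rewrite prednK ?expn_gt0.
apply/leqW/(@leq_card_in _ _ (fun x : n.-bseq bool => insub_bseq m x)) => x x'.
rewrite !inE !ltnS => lexm lex'm /(congr1 val) /=.
by rewrite !insub_bseqK // => /val_inj.
Qed.

(** The hypothesis excludes the default value in [C], so the minimum is attained. *)
Lemma C_program (U : TM) (x y : seq bool) :
  (exists p, computes U (pair p y) x) ->
  exists p, size p = C U x y /\ computes U (pair p y) x.
Proof.
move=> [p Up]; rewrite /C; case: pselect => [h | []].
  by case: ex_minnP => k /asboolP.
by exists (size p); apply/asboolP; exists p.
Qed.

Lemma card_complex_bseq (U : TM) (e y : seq bool) (n : nat) :
  (forall x, exists p, computes U (pair p y) x) ->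
  (forall p x, ~ computes U (pair (e ++ p) y) x) -> size e <= n ->
  2 ^ (n - size e) <= #|[set x : n.-bseq bool | n < C U x y]|.
Proof.
move=> total diverges le_en.
have /choice[f fP] : forall x : n.-bseq bool, exists p : n.-bseq bool,
    C U x y <= n -> computes U (pair p y) x.
  move=> x; have [p [sz_p Up]] := C_program (total x).
  (* If [p] is longer than [n], the default of [insub_bseq] is harmless: nothing is claimed then. *)
  by exists (insub_bseq n p) => le_n; rewrite insub_bseqK ?sz_p.
pose S := [set x : n.-bseq bool | C U x y <= n].
pose g (t : (n - size e).-tuple bool) := insub_bseq n (e ++ t).
have gE t : g t = e ++ t :> seq bool.
  by rewrite insub_bseqK // size_cat size_tuple subnKC.
(* Determinism of [U]: one program cannot produce two strings. *)
have card_fS : #|f @: S| = #|S|.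
  apply: card_in_imset => x x'; rewrite !inE => /fP Ux /fP Ux' eqf.
  by apply/val_inj/(computes_inj Ux); rewrite eqf.
pose G := [set g t | t in [set: (n - size e).-tuple bool]].
have card_G : #|G| = 2 ^ (n - size e).
  rewrite card_imset ?cardsT ?card_tuple ?card_bool // => t t' /(congr1 val) /=.
  by rewrite !gE => /eqP; rewrite eqseq_cat // eqxx => /eqP /val_inj.
have disj : [disjoint f @: S & G].
  rewrite disjoint_subset; apply/subsetP => _ /imsetP[x Sx ->].
  rewrite inE; apply/negP => /imsetP[t _ eqf].
  by move: Sx; rewrite inE => /fP; rewrite eqf gE; apply: diverges.
have -> : [set x : n.-bseq bool | n < C U x y] = ~: S.
  by apply/setP=> x; rewrite !inE ltnNge.
(* The type [n.-bseq bool] serves for strings and programs alike, so the complement of [S] has at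
   least as many elements as [G]. *)
rewrite -card_G -(leq_add2l #|S|) cardsC -card_fS -cardsT.
have := leq_card_setU (f @: S) G.
by rewrite disj => -[_ /eqP <-]; rewrite subset_leq_card ?subsetT.
Qed.

Lemma many_complex_bseq (U : TM) (e y : seq bool) (n : nat) :
  (forall x, exists p, computes U (pair p y) x) ->
  (forall p x, ~ computes U (pair (e ++ p) y) x) -> size e < n ->
  2 ^ n %/ 2 ^ (size e).+1 <=
    #|[set x : n.-bseq bool | (n - (size e).+1 <= size x <= n) && (n < C U x y)]|.
Proof.
move=> total diverges lt_en.
set B := [set x | _]; pose D := [set x : n.-bseq bool | size x < n - (size e).+1].
(* The quotient is exactly [2 ^ (n - (size e).+1)]; adding the bound on the number of too short
   strings doubles it to [2 ^ (n - size e)]. *)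
rewrite -expnB // -(leq_add2r (2 ^ (n - (size e).+1))) addnn -mul2n -expnS subnSK //.
apply: leq_trans (card_complex_bseq total diverges (ltnW lt_en)) _.
apply: leq_trans (leq_add (leqnn #|B|) (card_short_bseq n _)).
apply: leq_trans (leq_card_setU B D); apply/subset_leq_card/subsetP => x.
by rewrite !inE size_bseq andbT => ->; rewrite andbT ltnNge orbN.
Qed.

Theorem theorem2 (T : nat -> TM) (U : TM)
    (hT : enumeration T) (hU : universal T U) :
  (exists c d : nat, 0 < c /\ 0 < d /\
     exists N : nat, forall n : nat, N <= n ->
       2 ^ n %/ d <=
         #|[set x : n.-bseq bool | (n - c <= size x <= n) && (n < C U x (str n))]|)
  /\
  (exists c d : nat, 0 < c /\ 0 < d /\
     exists N : nat, forall n : nat, N <= n ->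
       2 ^ n %/ d <=
         #|[set x : n.-bseq bool | (n - c <= size x <= n) && (n < C U x [::])]|).
Proof.
have [i Ti] := hT loop_TM.
have total y x : exists p, computes U (pair p y) x.
  have [j Tj] := hT (const_TM x); exists (pair (str j) [::]); apply/hU.
  by rewrite Tj; apply: computes_const_TM.
(* [pair] appends its second component verbatim, so [e] is a prefix of every [pair (str i) p]. It
   does not depend on [y], so both halves share their constants. *)
pose e := pair (str i) [::].
have diverges y p x : ~ computes U (pair (e ++ p) y) x.
  have -> : e ++ p = pair (str i) p by rewrite /e /pair cats0 -catA.
  by move/hU; rewrite Ti; apply: loop_TM_diverges.
split; exists (size e).+1, (2 ^ (size e).+1); do 2![split; rewrite ?expn_gt0 //];
  exists (size e).+1 => n lt_en; exact: many_complex_bseq.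
Qed.
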